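(* Let $S$ be a semilattice-ordered semigroup and let $\mathrm{cl}$ be an algebraic closure operator on $S$. Let $X=\{A\in\mathcal{P}(S)\mid A^{\mathrm{cl}}=A\}$ and $A\star B=(AB)^{\mathrm{cl}}$ for $A,B\in X$. Let $B\in X$. The right translation $R_B:X\to X$ given by $R_B(A)=A\star B$ is spectral if and only if for every finite subset $F\subseteq S$ there exists a finite (possibly empty) family $G_i\in\mathcal{P}_{\mathrm{fin}}(S)$, $i\in I$, such that for all $A\in X$, $$F\subseteq A\star B\iff\exists i\in I\text{ such that }G_i\subseteq A.$$
   Context: A semilattice-ordered semigroup is a triple $(S,\cdot,\lor)$ with $S$ nonempty, $(S,\cdot)$ a semigroup, $(S,\lor)$ a semilattice (commutative, associative, idempotent), and $x(y\lor z)=xy\lor xz$, $(x\lor y)z=xz\lor yz$ for all $x,y,z\in S$. For $A,B\subseteq S$, $AB=\{ab\mid a\in A,b\in B\}$. $\mathcal{P}(S)$ is the power set of $S$ and $\mathcal{P}_{\mathrm{fin}}(A)$ is the set of finite subsets of $A$. A closure operator on $S$ is a map $\mathrm{cl}:\mathcal{P}(S)\to\mathcal{P}(S)$, written $A\mapsto A^{\mathrm{cl}}$, which is extensive, idempotent and order-preserving for inclusion. It is algebraic if $A^{\mathrm{cl}}=\bigcup\{F^{\mathrm{cl}}\mid F\in\mathcal{P}_{\mathrm{fin}}(A)\}$ for every $A\subseteq S$. The hull-kernel topology on $\mathcal{P}(S)$ has open subbasis $D(F)=\{A\in\mathcal{P}(S)\mid F\nsubseteq A\}$, $F\in\mathcal{P}_{\mathrm{fin}}(S)$.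 $X$ carries the subspace topology; since $\mathrm{cl}$ is algebraic, $X$ is a spectral space (quasi-compact, $T_0$, sober, with quasi-compact opens closed under finite intersections and forming a basis). A map between spectral spaces is spectral if the preimage of every quasi-compact open set is quasi-compact and open. *)

(* Defs.v *)
From HB Require Import structures.
From mathcomp Require Import all_boot.
From mathcomp Require Import boolp classical_sets functions cardinality.
From mathcomp Require Import topology.

Set Implicit Arguments.
Unset Strict Implicit.
Unset Printing Implicit Defensive.

Local Open Scope classical_set_scope.

(* The order of the semilattice is not part of the structure: only its join
   operation is, so this does not extend [joinSemilatticeType]. *)
HB.mixin Record Semigroup_isSemilatticeOrdered S of Semigroup S := {
  sjoin : S -> S -> S;
  sjoinC : commutative sjoin;
  sjoinA : associative sjoin;
  sjoinxx : idempotent_op sjoin;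
  mulg_sjoinr : right_distributive (@mul S) sjoin;
  mulg_sjoinl : left_distributive (@mul S) sjoin;
  slo_nonempty : inhabited S
}.

#[short(type="sloSemigroupType")]
HB.structure Definition SloSemigroup :=
  {S of Semigroup_isSemilatticeOrdered S & Semigroup S}.

Definition mulset (S : magmaType) (A B : set S) : set S :=
  [set mul a b | a in A & b in B].

Record closureOperator (S : Type) := ClosureOperator {
  closure_op :> set S -> set S;
  closure_op_ext : forall A, A `<=` closure_op A;
  closure_op_idem : forall A, closure_op (closure_op A) = closure_op A;
  closure_op_mono : forall A B, A `<=` B -> closure_op A `<=` closure_op B
}.

Definition algebraic (S : Type) (cl : set S -> set S) : Prop :=
  forall A, cl A = \bigcup_(F in [set F | finite_set F /\ F `<=` A]) cl F.

(* A copy of [set S] carrying the hull-kernel topology. *)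
Definition hullKernel (S : Type) : Type := set S.

Definition hullKernel_subbase (S : Type) (F : set S) : set (hullKernel S) :=
  [set A | ~ (F `<=` A)].

HB.instance Definition _ (S : Type) := Choice.copy (hullKernel S) (set S).
HB.instance Definition _ (S : Type) :=
  isSubBaseTopological.Build (hullKernel S)
    (@finite_set S) (@hullKernel_subbase S).

Section ClosedSets.
Variables (S : Type) (cl : closureOperator S).

Definition is_closed_set : set (hullKernel S) := [set A | cl A = A].

(* The underlying type is the sigma type of the fixed points of [cl];
   [initial_topology] of its inclusion is the subspace topology. *)
Definition closedSets : Type :=
  initial_topology (set_val : is_closed_set -> hullKernel S).

HB.instance Definition _ := Topological.on closedSets.

Definition carrier (A : closedSets) : set S := set_val A.

Definition closed_of (A : set S) : closedSets :=
  SigSub (mem_set (closure_op_idem cl A : is_closed_set (cl A))).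

HB.instance Definition _ := isPointed.Build closedSets (closed_of setT).

End ClosedSets.

Coercion carrier : closedSets >-> set.

Definition star (S : sloSemigroupType) (cl : closureOperator S)
  (A B : closedSets cl) : closedSets cl := closed_of cl (mulset A B).

Definition rtrans (S : sloSemigroupType) (cl : closureOperator S)
  (B : closedSets cl) : closedSets cl -> closedSets cl := fun A => star A B.

(* [compact] is quasi-compactness: no separation axiom is built in. *)
Definition spectral_map (T U : topologicalType) (f : T -> U) : Prop :=
  forall V : set U, open V -> compact V ->
    open (f @^-1` V) /\ compact (f @^-1` V).

(* Main.v *)
Require Import Defs.
From mathcomp Require Import all_boot finmap.
From mathcomp Require Import boolp classical_sets functions cardinality.
From mathcomp Require Import filter topology.

Local Open Scope classical_set_scope.

(** Write V(G) for the set of closed sets that contain G.  The quasi-compact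
    open sets of the space X of closed sets are exactly the complements of the
    finite unions of sets V(G), with each G finite ([compact_open_omitting],
    [open_omitting], [compact_omitting]).  Granting this, let R be the right
    translation by B.  The right-hand condition says that the R-preimage of
    every V(F), F finite, is a finite union of sets V(G).

    - If R is spectral, then the complement of V(F) is quasi-compact open, so
      its preimage is too, and is therefore the complement of such a union.
    - Conversely, a quasi-compact open set is the complement of a finite union
      of sets V(F), and taking preimages commutes with complements and unions,
      so by the condition the preimage is again the complement of a finite
      union of sets V(G).

    Algebraicity of the closure enters through [compact_omitting]: it makes X
    closed under limits of ultrafilters, where the limit of an ultrafilter of
    closed sets consists of the points that belong to almost all of them.

    That every quasi-compact open W has the stated form is a finiteness
    argument.  By openness each C in W has a basic neighbourhood inside W made
    of the closed sets that avoid a certain finite set; by quasi-compactness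
    finitely many of these cover W; so there is one finite set T such that
    membership of A in W depends only on the trace of A on T
    ([compact_open_finite_trace]).  The required sets G are then the finitely
    many subsets of T with V(G) disjoint from W. *)

Definition omitting (S : Type) (cl : closureOperator S) (I : finType)
    (G : I -> set S) : set (closedSets cl) :=
  [set A | forall i, ~ G i `<=` A].

Arguments omitting {S} cl {I} G.

Lemma open_not_supset (S : Type) (cl : closureOperator S) (F : set S) :
  finite_set F -> open [set A : closedSets cl | ~ F `<=` A].
Proof.
move=> finF; exists (hullKernel_subbase F) => //.
exists [set hullKernel_subbase F]; last by rewrite bigcup_set1.
move=> _ ->; exists [fset F]%fset; last first.
  by rewrite set_fset1 bigcap_set1.
by move=> G /fset1P ->; apply/mem_set.
Qed.

Lemma open_omitting (S : Type) (cl : closureOperator S) (I : finType)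
    (G : I -> set S) :
  (forall i, finite_set (G i)) -> open (omitting cl G).
Proof.
move=> finG; rewrite openE => A GA.
have nearA i : nbhs A [set A' : closedSets cl | ~ G i `<=` A'].
  by apply: open_nbhs_nbhs; split; [exact: open_not_supset|exact: GA].
exact: filter_forall nearA.
Qed.

(** A basic neighbourhood of [C] is given by finitely many finite sets not
    included in [C]; picking in each of them a point outside [C] shrinks the
    neighbourhood to one defined by points. *)
Lemma open_avoiding_sub (S : choiceType) (cl : closureOperator S)
    (W : set (closedSets cl)) (C : closedSets cl) :
  open W -> W C ->
  exists T : {fset S}, (forall x, x \in T -> ~ carrier C x) /\
    [set A : closedSets cl | forall x, x \in T -> ~ carrier A x] `<=` W.
Proof.
move=> [U opU <-] UC.
(* The topology generated by a subbase consists of the unions of finite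
   intersections of its members. *)
have [D DP UE] : exists2 D : set (set (hullKernel S)),
    D `<=` finI_from (@finite_set S) (@hullKernel_subbase S) &
    \bigcup_(V in D) V = U := opU.
rewrite -{}UE in UC *; have [V DV] := UC.
have [E _ VE] := DP V DV; rewrite -VE => VC.
have pick (F : E) : exists x, val F x /\ ~ carrier C x.
  by have /existsNP[x /not_implyP] := VC (val F) (valP F); exists x.
have [p pP] := choice pick.
exists [fset p F | F in {: E}]%fset; split=> [_ /imfsetP[F _ ->]|A TA].
  by case: (pP F).
exists V => //; rewrite -VE => F FE FA.
apply: (TA (p [` FE]%fset)); first by apply/imfsetP; exists [` FE]%fset.
by apply: FA; case: (pP [` FE]%fset).
Qed.

(** A finite subcover of [W] by neighbourhoods of the form given by
    [open_avoiding_sub] involves only finitely many points of [S]; these form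
    [T].  Such a neighbourhood contains [A] as soon as it contains a closed set
    whose trace on [T] includes that of [A], so an inclusion of traces is
    enough, rather than their equality. *)
Lemma compact_open_finite_trace (S : choiceType) (cl : closureOperator S)
    (W : set (closedSets cl)) :
  open W -> compact W ->
  exists T : {fset S}, forall A A' : closedSets cl,
    (forall x, x \in T -> carrier A x -> carrier A' x) -> W A' -> W A.
Proof.
move=> opW cW.
have nbh C : exists T : {fset S}, W C -> (forall x, x \in T -> ~ carrier C x) /\
    [set A : closedSets cl | forall x, x \in T -> ~ carrier A x] `<=` W.
  have [WC|nWC] := pselect (W C); last by exists fset0.
  by have [T TP] := open_avoiding_sub _ _ _ _ opW WC; exists T.
have [t tP] := choice nbh.
pose f C := [set A : closedSets cl | forall x, x \in t C -> ~ carrier A x].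
have opf C : W C -> open (f C).
  move=> _.
  rewrite (_ : f C = omitting cl (fun x : t C => [set val x])).
    by apply: open_omitting => x; exact: finite_set1.
  apply/seteqP; split=> A fA => [x /(_ (val x) erefl)|x xt Ax].
    exact: fA (valP x).
  by apply: (fA [` xt]%fset) => _ ->.
have Wf : W `<=` cover W f.
  by move=> C WC; exists C => //; case: (tP C WC).
rewrite compact_cover in cW; have [D DW WD] := cW _ _ _ opf Wf.
exists (\bigcup_(C <- D) t C)%fset => A A' AA' /WD[C /= CD fA'].
have WC : W C by apply/set_mem/DW.
case: (tP C WC) => _; apply => x xt Ax; apply: (fA' x xt).
by apply: AA' => //; apply/bigfcupP; exists C => //; rewrite CD.
Qed.

Lemma compact_open_omitting (S : choiceType) (cl : closureOperator S)
    (W : set (closedSets cl)) :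
  open W -> compact W ->
  exists (I : finType) (G : I -> set S),
    (forall i, finite_set (G i)) /\ W = omitting cl G.
Proof.
move=> opW cW; have [T TP] := compact_open_finite_trace _ _ _ opW cW.
pose pts (s : {set T}) : set S := [set val x | x in [set` s]].
pose I : finType := {s : {set T} | `[< forall A, W A -> ~ pts s `<=` A >]}.
exists I, (fun s => pts (val s)); split=> [s|].
  exact/finite_image/finite_finset.
apply/seteqP; split=> A WA => [s|]; first by have /asboolP := valP s; apply.
(* If A were outside W, then so would be every closed set that includes the
   trace of A on T; hence this trace would be one of the indexed sets. *)
apply: contrapT => nWA.
pose s := [set x : T | `[< carrier A (val x) >]]%SET.
have sI : `[< forall A, W A -> ~ pts s `<=` A >].
  apply/asboolP => A' WA' sA'; apply: nWA; apply: TP WA' => x xT Ax.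
  by apply: sA'; exists [` xT]%fset => //=; rewrite inE; apply/asboolP.
by apply: (WA (exist _ s sI)) => _ [x /= + <-]; rewrite inE => /asboolP.
Qed.

(** The limit of an ultrafilter of closed sets is the set [L] of the points
    lying in almost all of them.  If x is in the closure of [L], it is in the
    closure of a finite part of [L]; almost all closed sets contain that part,
    hence contain x.  So [L] is closed, and it inherits from the ultrafilter the
    property of not including any of the finite sets [G i]. *)
Lemma compact_omitting (S : choiceType) (cl : closureOperator S)
    (I : finType) (G : I -> set S) :
  algebraic cl -> (forall i, finite_set (G i)) -> compact (omitting cl G).
Proof.
move=> cl_alg finG; rewrite compact_ultra => F UF FG.
pose L : set S := [set x | F [set C : closedSets cl | carrier C x]].
have supset_large E : finite_set E -> E `<=` L ->
    F [set C : closedSets cl | E `<=` C].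
  move=> /finite_fsetP[E' ->] EL.
  exact: (@filter_bigI _ _ E' (fun x => [set C : closedSets cl | carrier C x])).
have clL : cl L = L.
  apply/seteqP; split; last exact: closure_op_ext.
  rewrite cl_alg => x [E [finE EL] Ex].
  apply: filterS (supset_large E finE EL) => C EC.
  have clC : cl C = C := set_mem (valP C).
  by rewrite /= -clC; apply: closure_op_mono Ex.
have carrierL : carrier (closed_of cl L) = L by exact: clL.
exists (closed_of cl L); split=> [i|W].
  rewrite carrierL => GL.
  have [C [Gn Gi]] := filter_ex (filterI FG (supset_large _ (finG i) GL)).
  exact: Gn i Gi.
rewrite nbhsE => -[U [opU UL] UW]; apply: filterS UW _.
have [T [TL TU]] := open_avoiding_sub _ _ _ _ opU UL.
apply: filterS TU _.
apply: (@filter_bigI _ _ T (fun x => [set C : closedSets cl | ~ carrier C x])).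
move=> x /TL; rewrite carrierL => Lx.
by case: (in_ultra_setVsetC [set C : closedSets cl | carrier C x] UF).
Qed.

Theorem proposition4p5 (S : sloSemigroupType) (cl : closureOperator S)
    (cl_alg : algebraic cl) (B : closedSets cl) :
  spectral_map (rtrans B) <->
  (forall F : set S, finite_set F ->
     exists (I : finType) (G : I -> set S),
       (forall i, finite_set (G i)) /\
       (forall A : closedSets cl,
          F `<=` star A B <-> exists i : I, G i `<=` A)).
Proof.
split=> [spB F finF|preimB V opV cV].
  (* The complement of V(F) is the case of a family with one member. *)
  have finF1 (i : unit) : finite_set F by [].
  have [opW cW] := spB _ (open_omitting _ cl _ _ finF1)
    (compact_omitting _ _ _ _ cl_alg finF1).
  have [I [G [finG WE]]] := compact_open_omitting _ _ _ opW cW.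
  exists I, G; split=> // A.
  have WA : (unit -> ~ F `<=` star A B) <-> omitting cl G A by case: _ / WE.
  split=> [FA|[i GA]]; apply: contrapT => nA.
    by apply: (proj2 WA) tt FA => i GA; apply: nA; exists i.
  exact: (proj1 WA (fun=> nA) i GA).
have [J [F [finF ->]]] := compact_open_omitting _ _ _ opV cV.
pose I j := projT1 (cid (preimB (F j) (finF j))).
pose G j : I j -> set S := projT1 (cid (projT2 (cid (preimB (F j) (finF j))))).
have GP j : (forall i, finite_set (G j i)) /\
    (forall A : closedSets cl, F j `<=` star A B <-> exists i, G j i `<=` A).
  exact: projT2 (cid (projT2 (cid (preimB (F j) (finF j))))).
pose H (k : {j : J & I j}) := G (tag k) (tagged k).
have finH k : finite_set (H k) by exact: (GP (tag k)).1.
have -> : rtrans B @^-1` omitting cl F = omitting cl H.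
  apply/seteqP; split=> A FA => [k HA|j].
    by apply: (FA (tag k)); apply/(GP (tag k)).2; exists (tagged k).
  by move=> /(GP j).2[i GA]; exact: (FA (existT I j i)).
by split; [exact: open_omitting|exact: compact_omitting].
Qed.
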